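(* Let $n\ge 2$, let $S\subseteq\mathbb{Z}_n$ satisfy $0\notin S$ and $-S=S$, let $u,v\in\mathbb{Z}_n$ and $t\in\mathbb{R}$, and let $N=\{(x,y)\mid x,y\in\mathbb{Z}_n,\ x>y,\ 2\mid (x-y)\}$. The circulant graph $G=\mathrm{Cay}(\mathbb{Z}_n,S)$ has fractional revival at time $t$ between the vertices $u$ and $v$ if and only if (a) $n$ is even; (b) $u$ and $v$ are antipodal vertices, that is, $u-v=n/2$ in $\mathbb{Z}_n$; (c) $\frac{t}{2\pi}\sum_{s\in S}(\omega_n^{xs}-\omega_n^{ys})\in\mathbb{Z}$ for all $(x,y)\in N$, where $\omega_n=\exp(2\pi\mathrm{i}/n)$. Moreover, if these conditions hold, and $\sum_{s\in S}(\omega_n^{xs}-\omega_n^{ys})$ are integers for all $(x,y)\in N$, then there is a minimum positive time $t=\frac{2\pi}{M}$ at which fractional revival occurs between $u$ and $v$, where $$M=\gcd\left(\left\{\sum_{s\in S}(\omega_n^{xs}-\omega_n^{ys})\right\}_{(x,y)\in N}\right).$$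
   Context: $\mathbb{Z}_n=\{0,1,\ldots,n-1\}$ is the additive group of integers modulo $n$; in the definition of $N$ its elements are regarded as integers $0,\ldots,n-1$. The graph $\mathrm{Cay}(\mathbb{Z}_n,S)$ has vertex set $\mathbb{Z}_n$, with $u,v$ adjacent if and only if $u-v\in S$. For a graph $G$ with adjacency matrix $A_G$, the transition matrix is $H_{A_G}(t)=\exp(\mathrm{i}tA_G)$, $t\in\mathbb{R}$, and $\mathbf{e}_u$ is the standard basis vector indexed by the vertex $u$. For distinct vertices $u,v$, $G$ has fractional revival at time $t$ from $u$ to $v$ if $H_{A_G}(t)\mathbf{e}_u=\alpha\mathbf{e}_u+\beta\mathbf{e}_v$ for some complex numbers $\alpha,\beta$ with $|\alpha|^2+|\beta|^2=1$ (equivalently $|H_{A_G}(t)_{u,u}|^2+|H_{A_G}(t)_{u,v}|^2=1$); the cases $\alpha=0$ (perfect state transfer) and $\beta=0$ (periodicity at $u$) are included. Fractional revival from $u$ to $v$ at time $t$ implies fractional revival from $v$ to $u$ at time $t$, so one speaks of fractional revival between $u$ and $v$.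
   Formalization: Since β=0 is allowed (e.g. t=0, n=3 gives revival), necessity of (a),(b) is claimed only when G is not periodic at u at time t; (c) stays necessary always. The minimum-time clause assumes M≠0, as 2π/M is undefined if M=0 (e.g. n=2 or S empty). *)

(* Defs.v *)
From HB Require Import structures.
From mathcomp Require Import all_boot all_order all_algebra.
From mathcomp Require Import complex.
From mathcomp Require Import all_classical all_reals all_analysis.
Set Implicit Arguments.
Unset Strict Implicit.
Unset Printing Implicit Defensive.
Import Order.TTheory GRing.Theory Num.Theory numFieldNormedType.Exports.
Local Open Scope ring_scope.

(* The limit is that of the normed module 'M[K]_m (max norm); stating it for an
   abstract K is what lets the topology on K, and on K = R[i], be inferred. *)
Definition expm (K : numFieldType) (m : nat) (A : 'M[K]_m) : 'M[K]_m :=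
  limn (series (fun k : nat => (k`!)%:R^-1 *: A ^+ k)).

Definition adjmx (R : realType) (m : nat) (e : rel 'I_m) : 'M[R[i]]_m :=
  \matrix_(u, v) (e u v)%:R.

Definition transmx (R : realType) (m : nat) (e : rel 'I_m) (t : R) :
    'M[R[i]]_m :=
  expm (('i * t%:C)%C *: adjmx R e).

Definition std_basis (R : realType) (m : nat) (u : 'I_m) : 'cV[R[i]]_m :=
  delta_mx u 0.

Definition revival_from (R : realType) (m : nat) (e : rel 'I_m) (t : R)
    (u v : 'I_m) : Prop :=
  u <> v /\
  exists a b : R[i], `|a| ^+ 2 + `|b| ^+ 2 = 1 /\
    transmx e t *m std_basis R u = a *: std_basis R u + b *: std_basis R v.

Definition revival (R : realType) (m : nat) (e : rel 'I_m) (t : R)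
    (u v : 'I_m) : Prop :=
  revival_from e t u v /\ revival_from e t v u.

(* This is the case b = 0 of [revival_from], which then holds from u to every
   other vertex v; it always occurs at t = 0. *)
Definition periodic_at (R : realType) (m : nat) (e : rel 'I_m) (t : R)
    (u : 'I_m) : Prop :=
  exists a : R[i], `|a| = 1 /\ transmx e t *m std_basis R u = a *: std_basis R u.

(* 'Z_n is the ring of integers modulo n only for 1 < n. *)
Definition cay (n : nat) (S : {set 'Z_n}) : rel 'Z_n :=
  fun u v => u - v \in S.

Definition omega (R : realType) (n : nat) : R[i] :=
  (cos (2 * pi / n%:R) +i* sin (2 * pi / n%:R))%C.

(* Order and subtraction are those of the representatives 0, ..., n-1. *)
Definition even_pairs (n : nat) : {set 'Z_n * 'Z_n} :=
  [set p : 'Z_n * 'Z_n | (p.2 < p.1)%N && (2 %| p.1 - p.2)%N]%SET.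

Definition eig_diff (R : realType) (n : nat) (S : {set 'Z_n}) (x y : 'Z_n) :
    R[i] :=
  \sum_(s in S) (omega R n ^+ (x * s)%N - omega R n ^+ (y * s)%N).

Definition antipodal (n : nat) (u v : 'Z_n) : Prop :=
  u - v = (n./2)%:R.

Definition integral_phases (R : realType) (n : nat) (S : {set 'Z_n}) (t : R) :
    Prop :=
  forall x y : 'Z_n, (x, y) \in even_pairs n ->
    exists k : int, (t / (2 * pi))%:C%C * eig_diff R S x y = k%:~R.

(* Main.v *)
(* A circulant graph is diagonalised by the characters chi_x of Z_n, so its
   transition matrix is H = sum_x exp(i t lam_x) E_x with real eigenvalues lam_x
   and E_x(i,j) = chi_x(i-j) / n; it is again a symmetric circulant.
   Revival H e_u = a e_u + b e_v amounts, by Fourier inversion, to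
   exp(i t lam_x) = a + b chi_x(u-v) for all x.  If b <> 0, the symmetry of H
   forces 2(u-v) = 0, so chi_x(u-v) = (-1)^x and the phases depend only on the
   parity of x, which is (c).  Conversely, if they depend only on the parity of
   x, with values p and q, then a = (p+q)/2 and b = (p-q)/2 work.
   For the minimum time, Bezout turns the integrality of t/(2 pi) times each
   difference into that of t/(2 pi) times their gcd. *)
Require Import Defs.
From HB Require Import structures.
From mathcomp Require Import all_boot all_order all_algebra.
From mathcomp Require Import complex.
From mathcomp Require Import ring lra zify.
From mathcomp Require Import all_classical all_reals all_analysis.
Import Order.TTheory GRing.Theory Num.Theory numFieldNormedType.Exports.
Local Open Scope ring_scope.
Set Implicit Arguments.
Unset Strict Implicit.
Unset Printing Implicit Defensive.

(** * Exponential of a spectrally decomposed matrix *)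

(** Orthogonal idempotents summing to the identity make powers act on the coefficients alone, so the
    matrix series splits into scalar ones. *)
Lemma expm_spectral (K : numFieldType) (m : nat) (I : finType)
    (E : I -> 'M[K]_m) (l f : I -> K) :
  (forall x y, E x *m E y = if x == y then E x else 0) ->
  \sum_x E x = 1%:M ->
  (forall x,
    (series (fun k => (k`!)%:R^-1 * l x ^+ k) @ \oo --> f x)%classic) ->
  expm (\sum_x l x *: E x) = \sum_x f x *: E x.
Proof.
move=> Eort E1 cvl.
have powE k : (\sum_x l x *: E x) ^+ k = \sum_x l x ^+ k *: E x.
  elim: k => [|k IH].
    by rewrite expr0 -[LHS]E1; apply: eq_bigr => x _; rewrite expr0 scale1r.
  rewrite exprS IH -[_ * _]/(_ *m _) mulmx_suml; apply: eq_bigr => x _.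
  rewrite mulmx_sumr (bigD1 x) //= big1 => [|y yx].
    by rewrite addr0 -scalemxAl -scalemxAr scalerA Eort eqxx exprS.
  by rewrite -scalemxAl -scalemxAr Eort eq_sym (negbTE yx) !scaler0.
rewrite /expm; apply: cvg_lim => //.
rewrite [X in (X @ _)%classic](_ : _ = fun N =>
    \sum_x series (fun k => k`!%:R^-1 * l x ^+ k) N *: E x); last first.
  apply/funext => N; rewrite /series /=.
  under eq_bigr do rewrite powE scaler_sumr.
  rewrite exchange_big; apply: eq_bigr => x _.
  by rewrite scaler_suml; apply: eq_bigr => k _; rewrite scalerA.
apply: (@cvg_big _ I +%R 0 xpredT (@add_continuous _)) => x _.
exact: cvgZr_tmp.
Qed.

(** * Unit complex numbers and the exponential series on the imaginary axis *)

Definition cis (R : realType) (x : R) : R[i] := (cos x +i* sin x)%C.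

Lemma cis0 (R : realType) : cis (0 : R) = 1.
Proof. by rewrite /cis cos0 sin0. Qed.

Lemma cisD (R : realType) (x y : R) : cis (x + y) = cis x * cis y.
Proof. by rewrite /cis cosD sinD; simpc; congr Complex; rewrite addrC. Qed.

Lemma cisMn (R : realType) (x : R) (n : nat) : cis (x *+ n) = cis x ^+ n.
Proof.
elim: n => [|n IH]; first by rewrite mulr0n cis0.
by rewrite mulrS cisD IH exprS.
Qed.

Lemma cisN (R : realType) (x : R) : cis (- x) = (cis x)^-1.
Proof.
have cis_neq0 : cis x != 0.
  apply/eqP => x0; have := oner_neq0 R[i].
  by rewrite -(cis0 R) -(subrr x) cisD x0 mul0r eqxx.
by apply: (mulfI cis_neq0); rewrite -cisD subrr cis0 mulfV.
Qed.

Lemma conjc_cis (R : realType) (x : R) : ((cis x)^*)%C = (cis x)^-1.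
Proof. by rewrite -cisN /cis cosN sinN. Qed.

Lemma cis_2piz (R : realType) (k : int) : cis (2 * pi * k%:~R : R) = 1.
Proof.
have cis_2pin (n : nat) : cis (2 * pi * n%:R : R) = 1.
  rewrite mulr_natr cisMn -mulr_natl mulr1 mulr_natl.
  by rewrite /cis cos2pi sin2pi expr1n.
case: k => n; first exact: cis_2pin.
by rewrite NegzE mulrNz mulrN cisN [_.+1%:~R]/(n.+1%:R) cis_2pin invr1.
Qed.

(* [cos x = 1] makes [sin (x / 2)] vanish, which on [0, 2 pi) forces x = 0. *)
Lemma cis_eq1 (R : realType) (x : R) :
  cis x = 1 -> exists k : int, x = 2 * pi * k%:~R.
Proof.
move=> cx1; have pi2_gt0 : 0 < 2 * pi :> R by rewrite mulr_gt0 ?pi_gt0.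
pose k := Num.floor (x / (2 * pi)); exists k; apply/eqP; rewrite -subr_eq0.
set y := x - _; have /andP[kle klt] := floor_itv (x / (2 * pi)).
have y_ge0 : 0 <= y by rewrite subr_ge0 mulrC -ler_pdivlMr.
have y_lt : y < 2 * pi.
  by rewrite ltrBlDl -{2}(mulr1 (2 * pi)) -mulrDr -ltr_pdivrMl // mulrC -intrD1.
have cy1 : cis y = 1 by rewrite cisD cx1 cisN cis_2piz invr1 mulr1.
have /eqP : sin (y / 2) ^+ 2 = 0.
  have [+ _] := cy1; rewrite {1}(splitr y) -mulr2n cos_mulr2n sin2cos2 => /eqP.
  rewrite subr_eq -(mulr2n 1) eqr_pMn2r // => /eqP ->; exact: subrr.
rewrite expf_eq0 /= eq_le => /andP[sy_le0 _].
rewrite eq_le y_ge0 andbT leNgt; apply/negP => y_gt0.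
suff : 0 < sin (y / 2) by rewrite ltNge sy_le0.
by apply: sin_gt0_pi; rewrite divr_gt0 // ltr_pdivrMr // mulrC.
Qed.

(* The canonical topology of a numeric field is keyed on [Num.NumField.sort], so
   it is not found on [R[i]] itself. *)
Definition complexK (R : realType) : numFieldType := R[i].

Lemma cvg_real_complex (R : realType) (u : nat -> R) (a : R) :
  (u @ \oo --> a)%classic ->
  ((fun n => (u n)%:C%C : complexK R) @ \oo --> (a%:C%C : complexK R))%classic.
Proof.
move=> /cvgrPdist_lt cu; apply/cvgrPdist_lt => e e0.
(* A positive element of [R[i]] is real, so the radius is its own real part. *)
have eE : (complex.Re e)%:C%C = e by rewrite RRe_real // gtr0_real.
have : 0 < complex.Re e by rewrite -ltcR eE.
move=> /cu; apply: filterS => n.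
by rewrite -ltcR eE -rmorphB normc_def /= expr0n addr0 sqrtr_sqr.
Qed.

(** Terms of even index form the cosine series, those of odd index i times the sine series. *)
Lemma cvg_series_cis (R : realType) (y : R) :
  (series (fun k => (k`!)%:R^-1 * ('i * y%:C)%C ^+ k : complexK R) @ \oo
    --> (cis y : complexK R))%classic.
Proof.
have -> : cis y = (cos y)%:C%C + 'i%C * (sin y)%:C%C by rewrite [LHS]complexE.
rewrite [X in (X @ _)%classic](_ : _ = fun N =>
  (series (cos_coeff y) N)%:C%C + 'i%C * (series (sin_coeff y) N)%:C%C);
  last first.
  apply/funext => N; rewrite /series /= !rmorph_sum mulr_sumr -big_split /=.
  apply: eq_bigr => k _.
  rewrite exprMn; have -> : ('i : R[i])%C ^+ k =
     ((~~ odd k)%:R * (-1) ^+ k./2) + 'i%C * ((odd k)%:R * (-1) ^+ k.-1./2).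
    have kE := odd_double_half k.
    rewrite -{1}kE -mul2n exprD exprM sqr_i; case: (boolP (odd k)) => ok.
      have -> : k.-1./2 = k./2 by rewrite -{1}kE ok /= doubleK.
      by rewrite mul0r add0r mul1r expr1.
    by rewrite expr0 mul0r mulr0 addr0.
  rewrite /cos_coeff /sin_coeff /= !rmorphM !rmorphXn !fmorphV.
  rewrite !rmorphN1 !rmorph_nat.
  by rewrite mulrDl mulrDr; congr (_ + _); rewrite mulrC -!mulrA.
(* The abstract K lets the limit laws find the topology before [complexK R] is substituted. *)
have cvgDM (K : numFieldType) (p q : nat -> K) (a b c : K) :
    (p @ \oo --> a -> q @ \oo --> b ->
    (fun n => p n + c * q n) @ \oo --> a + c * b)%classic.
  by move=> pa qb; apply: cvgD => //; apply: cvgM => //; exact: cvg_cst.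
have cvg_cos : (series (cos_coeff y) @ \oo --> cos y)%classic.
  by have := @is_cvg_series_cos_coeff R y; rewrite cos.unlock.
have cvg_sin : (series (sin_coeff y) @ \oo --> sin y)%classic.
  by have := @is_cvg_series_sin_coeff R y; rewrite sin.unlock.
exact: (@cvgDM (complexK R) _ _ _ _ 'i%C
  (cvg_real_complex cvg_cos) (cvg_real_complex cvg_sin)).
Qed.

(** * Characters of Z_n and their projections *)

Lemma omegaX (R : realType) (n k : nat) :
  omega R n ^+ k = cis (2 * pi / n%:R *+ k : R).
Proof. by rewrite cisMn. Qed.

Definition chi (R : realType) (n : nat) (x i : 'Z_n) : R[i] :=
  omega R n ^+ (x * i)%N.

Section Characters.
Variables (R : realType) (n : nat).
Hypothesis n_gt1 : (1 < n)%N.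
Implicit Types x y i j : 'Z_n.
Local Notation chi := (@chi R n).

Let n_neq0 : n%:R != 0 :> R.
Proof. by rewrite pnatr_eq0 -lt0n ltnW. Qed.

Lemma omega_order : omega R n ^+ n = 1.
Proof.
rewrite omegaX -mulr_natr divfK // -[2 * pi]mulr1 -[1]/(1%:~R).
exact: cis_2piz.
Qed.

Lemma omegaX_eq1 k : omega R n ^+ k = 1 -> (n %| k)%N.
Proof.
have pi2_neq0 : 2 * pi != 0 :> R by rewrite mulf_neq0 // gt_eqF ?pi_gt0.
rewrite omegaX => /cis_eq1[m]; rewrite -mulr_natr -mulrA => /(mulfI pi2_neq0).
move/(canRL (mulVKf n_neq0)) => kE.
have : k%:Z = n%:Z * m by apply: (@intr_inj R); rewrite intrM.
by move/(congr1 absz); rewrite abszM /= => ->; rewrite dvdn_mulr.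
Qed.

Lemma chiC x i : chi x i = chi i x.
Proof. by rewrite /chi mulnC. Qed.

Lemma chi0 x : chi x 0 = 1.
Proof. by rewrite /chi muln0 expr0. Qed.

Lemma omegaX_mod k : omega R n ^+ (k %% n) = omega R n ^+ k.
Proof. exact/expr_mod/omega_order. Qed.

(** Addition in ['Z_n] reduces modulo n, which powers of [omega] do not see. *)
Lemma chiD x i j : chi x (i + j) = chi x i * chi x j.
Proof.
rewrite /chi -exprD -mulnDr -omegaX_mod -[RHS]omegaX_mod; congr (_ ^+ _).
have -> : (i + j)%R = ((i + j) %% n)%N :> nat by congr modn; exact: Zp_cast.
by rewrite modnMmr.
Qed.

Lemma chiN x i : chi x (- i) = (chi x i)^-1.
Proof.
have chi_neq0 : chi x i != 0.
  apply/eqP => c0; have := oner_neq0 R[i].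
  by rewrite -(chi0 x) -(subrr i) chiD c0 mul0r eqxx.
by apply: (mulfI chi_neq0); rewrite -chiD subrr chi0 mulfV.
Qed.

Lemma conjc_chi x i : ((chi x i)^*)%C = chi x (- i).
Proof. by rewrite chiN /chi omegaX conjc_cis. Qed.

(** For nonzero x, shifting the index by 1 multiplies the sum by [chi x 1], which is not 1, so the
    sum vanishes. *)
Lemma sum_chi x : \sum_i chi x i = n%:R * (x == 0)%:R.
Proof.
have [->|x_neq0] := eqVneq x 0.
  under eq_bigr do rewrite chiC chi0.
  by rewrite sumr_const card_ord Zp_cast // mulr1.
apply/eqP; rewrite mulr0; have: chi x 1 != 1.
  apply: contra x_neq0 => /eqP; rewrite /chi.
  have -> : (1 : 'Z_n)%R = 1%N :> nat by [].
  rewrite muln1 => /omegaX_eq1.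
  rewrite /dvdn modn_small => [/eqP x0|]; first by apply/eqP/val_inj.
  by have := ltn_ord x; rewrite [X in (_ < X)%N]Zp_cast.
apply: contraNT => s_neq0; apply/eqP/(mulIf s_neq0); rewrite mul1r mulr_sumr.
rewrite [RHS](reindex_inj (addrI 1)) /=.
by apply: eq_bigr => i _; rewrite chiD.
Qed.

Definition chi_proj x : 'M[R[i]]_((Zp_trunc n).+2) :=
  \matrix_(i, j) (n%:R^-1 * chi x (i - j)).

Let n_neq0C : n%:R != 0 :> R[i].
Proof. by rewrite pnatr_eq0 -lt0n ltnW. Qed.

Lemma chi_proj_ort x y :
  chi_proj x *m chi_proj y = if x == y then chi_proj x else 0.
Proof.
apply/matrixP => i j; rewrite mxE.
transitivity (n%:R^-1 * n%:R^-1 * chi x i * chi y (- j) * \sum_k chi (y - x) k).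
  rewrite mulr_sumr; apply: eq_bigr => k _; rewrite !mxE.
  rewrite !chiD chiC [chi (y - x) k]chiC chiD.
  rewrite [chi i x]chiC [chi k (- x)]chiN [chi x (- k)]chiN [chi k x]chiC.
  rewrite [chi k y]chiC; ring.
rewrite sum_chi subr_eq0 eq_sym; case: eqVneq => [<-|_].
  by rewrite mulr1 !mxE chiD; field.
by rewrite !mulr0 mxE.
Qed.

Lemma sum_chi_proj : \sum_x chi_proj x = 1%:M.
Proof.
apply/matrixP => i j; rewrite summxE mxE.
under eq_bigr do rewrite mxE chiC.
by rewrite -mulr_sumr sum_chi subr_eq0 mulKf.
Qed.

End Characters.

(** * Eigenvalues and transition matrix of a circulant graph *)

Section Spectrum.
Variables (R : realType) (n : nat).
Hypothesis n_gt1 : (1 < n)%N.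
Variable S : {set 'Z_n}.
Hypothesis SN : -%R @: S = S.
Implicit Types x y i j d : 'Z_n.

(** The real part gives a phase angle in R; [eigvalE] shows that nothing is lost. *)
Definition eigval x : R := complex.Re (\sum_(s in S) chi R x s).

Lemma memN_conn x : (- x \in S) = (x \in S).
Proof. by rewrite -{1}SN mem_imset //; exact: oppr_inj. Qed.

(** Conjugation sends [chi x s] to [chi x (- s)], so it permutes the summands because S is
    symmetric. *)
Lemma eigvalE x : (eigval x)%:C%C = \sum_(s in S) chi R x s.
Proof.
set z := \sum_(s in S) _; have zJ : (z^*)%C = z.
  rewrite rmorph_sum /= (reindex_inj oppr_inj) /=.
  apply: eq_big => s; first exact: memN_conn.
  by move=> _; rewrite conjc_chi // opprK.
rewrite /eigval -/z [RHS]complexE.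
suff -> : complex.Im z = 0 by rewrite mulr0 addr0.
move: zJ; case: (z) => a b /= [] /eqP; rewrite eq_sym -subr_eq0 opprK -mulr2n.
by rewrite mulrn_eq0 /= => /eqP.
Qed.

Lemma eig_diffE x y : eig_diff R S x y = (eigval x - eigval y)%:C%C.
Proof. by rewrite /eig_diff sumrB rmorphB /= !eigvalE. Qed.

Lemma eigvalN x : eigval (- x) = eigval x.
Proof.
apply: (@complexI R); rewrite !eigvalE (reindex_inj oppr_inj) /=.
apply: eq_big => s; first exact: memN_conn.
by move=> _; rewrite chiC !chiN // chiC chiN // invrK.
Qed.

Let n_neq0C : n%:R != 0 :> R[i].
Proof. by rewrite pnatr_eq0 -lt0n ltnW. Qed.

Lemma adjmx_spectral :
  adjmx R (cay S) = \sum_x (eigval x)%:C%C *: chi_proj R x.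
Proof.
apply/matrixP => i j; rewrite mxE summxE.
transitivity (n%:R^-1 * \sum_(s in S) \sum_x chi R (s + (i - j)) x); last first.
  rewrite exchange_big /= mulr_sumr; apply: eq_bigr => x _.
  rewrite !mxE eigvalE mulrCA mulr_suml; congr (_ * _).
  by apply: eq_bigr => s _; rewrite chiC chiD // !(chiC x).
under eq_bigr do rewrite sum_chi //.
(* The inner sum is nonzero only at [s = - (i - j)], hence the passage to the opposite element of
   S. *)
rewrite -mulr_sumr mulKf // /cay -memN_conn.
have [ijS|ijNS] := boolP (- (i - j) \in S).
  rewrite (bigD1 (- (i - j))) //= addNr eqxx big1 ?addr0 // => s /andP[_].
  by rewrite -subr_eq0 opprK => /negPf ->.
rewrite big1 // => s sS; case: eqP => // /eqP; rewrite addr_eq0 => /eqP sE.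
by rewrite -sE sS in ijNS.
Qed.

(** The inverse Fourier transform of the phases, which by [transmxE] is the transition matrix entry
    at offset d. *)
Definition propagator (t : R) d : R[i] :=
  n%:R^-1 * \sum_x cis (t * eigval x) * chi R x d.

Lemma transmxE t i j : transmx (cay S) t i j = propagator t (i - j).
Proof.
rewrite /transmx adjmx_spectral scaler_sumr.
under eq_bigr => x _.
  rewrite scalerA -mulrA -rmorphM; over.
rewrite (expm_spectral (f := fun x => cis (t * eigval x))).
- rewrite summxE /propagator mulr_sumr; apply: eq_bigr => x _.
  by rewrite !mxE mulrCA.
- exact: chi_proj_ort.
- exact: sum_chi_proj.
- by move=> x; exact: cvg_series_cis.
Qed.

Lemma propagatorN t d : propagator t (- d) = propagator t d.
Proof.
rewrite /propagator (reindex_inj oppr_inj) /=; congr (_ * _).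
apply: eq_bigr => x _.
by rewrite eigvalN chiN // chiC chiN // chiC invrK.
Qed.

Lemma propagator_inv t x :
  cis (t * eigval x) = \sum_d propagator t d * chi R x (- d).
Proof.
transitivity (n%:R^-1 * \sum_y cis (t * eigval y) * \sum_d chi R (y - x) d).
  under eq_bigr do rewrite sum_chi // mulrCA.
  rewrite -mulr_sumr mulKf // (bigD1 x) //= subrr eqxx mulr1.
  by rewrite big1 ?addr0 // => y; rewrite subr_eq0 => /negPf ->; rewrite mulr0.
rewrite /propagator; under [RHS]eq_bigr do rewrite -mulrA mulr_suml.
rewrite -mulr_sumr exchange_big /=; congr (_ * _); apply: eq_bigr => y _.
rewrite mulr_sumr; apply: eq_bigr => d _.
rewrite -mulrA; congr (_ * _).
by rewrite chiC chiD // chiC chiN // [chi R x (- d)]chiN // [chi R d x]chiC.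
Qed.

Lemma transmx_basis (t : R) u i :
  (transmx (cay S) t *m std_basis R u) i 0 = propagator t (i - u).
Proof. by rewrite /std_basis -colE mxE transmxE. Qed.

End Spectrum.

(** * Phases and fractional revival *)

Section Revival.
Variables (R : realType) (n : nat).
Hypothesis n_gt1 : (1 < n)%N.
Implicit Types (d x y : 'Z_n).

(** The representative of d lies strictly between 0 and n, so if n divides its double, the two are
    equal. *)
Lemma double_eq0_half d :
  d != 0 -> d + d = 0 -> ~~ odd n /\ d = (n./2)%:R.
Proof.
move=> d_neq0 /(congr1 val)/= dd0.
have d_gt0 : (0 < d)%N.
  by rewrite lt0n; apply: contra d_neq0 => /eqP d0; apply/eqP/val_inj.
have d_lt : (d < n)%N by have := ltn_ord d; rewrite [X in (_ < X)%N]Zp_cast.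
have {}dd0 : (n %| d + d)%N.
  by rewrite /dvdn -[X in (_ %% X)%N](Zp_cast n_gt1) dd0.
have nE : n = d.*2.
  by case/dvdnP: dd0 => -[|[|k]]; rewrite -addnn; lia.
split; first by have := congr1 odd nE; rewrite odd_double => ->.
by have := congr1 half nE; rewrite doubleK => ->; rewrite natr_Zp.
Qed.

Lemma half_double_eq0 : ~~ odd n -> (n./2)%:R + (n./2)%:R = 0 :> 'Z_n.
Proof. by move=> n_even; rewrite -natrD addnn even_halfK // pchar_Zp. Qed.

Lemma half_neq0 : (n./2)%:R != 0 :> 'Z_n.
Proof.
have h_gt0 : (0 < n./2)%N by rewrite half_gt0.
have h_lt : (n./2 < n)%N by rewrite -divn2 ltn_Pdiv // ltnW.
apply/eqP => /(congr1 val); rewrite /= val_Zp_nat // modn_small // => h0.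
by rewrite h0 in h_gt0.
Qed.

(** [chi R 1 d] squares to 1 but is not 1, as n does not divide d; so it is -1, and [chi R x d] is
    its x-th power. *)
Lemma chi_half x d : d != 0 -> d + d = 0 -> chi R x d = (-1) ^+ odd x.
Proof.
move=> d_neq0 dd0; have chi1E : chi R 1 d = omega R n ^+ d.
  by rewrite /chi; have -> : (1 : 'Z_n)%R = 1%N :> nat by []; rewrite mul1n.
have /eqP : chi R 1 d ^+ 2 = 1 by rewrite expr2 -chiD // dd0 chi0.
rewrite chi1E sqrf_eq1 => /orP[/eqP /omegaX_eq1 nd|/eqP wd]; last first.
  by rewrite /chi mulnC exprM wd signr_odd.
have d_lt : (d < n)%N by have := ltn_ord d; rewrite [X in (_ < X)%N]Zp_cast.
case/negP: d_neq0; apply/eqP/val_inj/eqP.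
by move: (nd n_gt1); rewrite /dvdn modn_small.
Qed.

Lemma even_pairs_odd x y : (x, y) \in even_pairs n -> odd x = odd y.
Proof.
rewrite inE /= => /andP[yx]; rewrite dvdn2 oddB; last exact: ltnW.
by move/negbTE; case: (odd x); case: (odd y).
Qed.

Variable S : {set 'Z_n}.
Hypothesis SN : -%R @: S = S.
Implicit Types u v i : 'Z_n.

(** Condition (c) becomes equality of phases: the two angles differ by a whole multiple of 2 pi. *)
Lemma integral_phaseP (t : R) x y :
  (exists k : int, (t / (2 * pi))%:C%C * eig_diff R S x y = k%:~R) <->
  cis (t * eigval R S x) = cis (t * eigval R S y).
Proof.
have pi2_neq0 : 2 * pi != 0 :> R by rewrite mulf_neq0 // gt_eqF ?pi_gt0.
rewrite eig_diffE // -rmorphM; split=> [[k kE]|xy].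
  have {}kE : t / (2 * pi) * (eigval R S x - eigval R S y) = k%:~R.
    by apply: (@complexI R); rewrite kE rmorph_int.
  have -> : t * eigval R S x = t * eigval R S y + 2 * pi * k%:~R.
    by rewrite -kE mulrA (mulrC (2 * pi)) divfK // mulrBr addrC subrK.
  by rewrite cisD cis_2piz mulr1.
have /cis_eq1[k kE] : cis (t * eigval R S x - t * eigval R S y) = 1.
  by rewrite cisD cisN xy -cisN -cisD subrr cis0.
exists k; rewrite -[RHS](rmorph_int (real_complex R)); congr (_%:C)%C.
by rewrite mulrAC mulrBr kE mulrAC divff // mul1r.
Qed.

Lemma revival_from_propagator (t : R) u v (a b : R[i]) :
  transmx (cay S) t *m std_basis R u =
    a *: std_basis R u + b *: std_basis R v <->
  forall i, propagator S t (i - u) = a * (i == u)%:R + b * (i == v)%:R.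
Proof.
split=> [tu i|tu].
  by rewrite -transmx_basis // tu /std_basis !mxE !eqxx !andbT.
apply/matrixP => i j; rewrite ord1 transmx_basis // tu.
by rewrite /std_basis !mxE !eqxx !andbT.
Qed.

Lemma revival_from_phase (t : R) u v (a b : R[i]) x :
  u <> v ->
  (forall i, propagator S t (i - u) = a * (i == u)%:R + b * (i == v)%:R) ->
  cis (t * eigval R S x) = a + b * chi R x (u - v).
Proof.
(* After the shift by u, only the terms at u and v survive in the inversion formula. *)
move=> uv tu; rewrite propagator_inv // (reindex_inj (addIr (- u))) /=.
under eq_bigr do rewrite tu opprB.
rewrite (bigD1 u) //= (bigD1 v) /=; last by apply/eqP => vu; apply: uv.
rewrite subrr chi0 !eqxx; have /eqP/negPf uvF := uv.
rewrite uvF eq_sym uvF big1 => [|i /andP[/negPf -> /negPf ->]].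
  by rewrite !mulr0 !mulr1 addr0 add0r addr0.
by rewrite !mulr0 addr0 mul0r.
Qed.

(* A symmetric circulant has equal entries at offsets [v - u] and [u - v]. *)
Lemma revival_from_double (t : R) u v (a b : R[i]) :
  u <> v ->
  (forall i, propagator S t (i - u) = a * (i == u)%:R + b * (i == v)%:R) ->
  b != 0 -> (u - v) + (u - v) = 0.
Proof.
move=> uv tu b_neq0; have /eqP/negPf uvF := uv.
(* At this vertex the offset is [u - v], so the entry is b by symmetry; as b is nonzero, the vertex
   must be v. *)
have := tu (u - v + u); rewrite addrK -propagatorN // opprB tu eqxx.
rewrite eq_sym uvF mulr0 add0r mulr1 -subr_eq0 addrK subr_eq0 uvF mulr0 add0r.
have [uvv _|_ /eqP] := eqVneq (u - v + u) v; first by rewrite addrA uvv subrr.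
by rewrite mulr0 (negPf b_neq0).
Qed.

Lemma revival_from_integral (t : R) u v :
  revival_from (cay S) t u v -> integral_phases S t.
Proof.
move=> [uv [a [b [_ /revival_from_propagator tu]]]] x y xy.
apply/integral_phaseP; rewrite !(revival_from_phase _ uv tu).
(* For b = 0 all phases equal a; otherwise the character at [u - v] depends only on parity. *)
have [->|b_neq0] := eqVneq b 0; first by rewrite !mul0r.
have uv_neq0 : u - v != 0 by rewrite subr_eq0; apply/eqP.
have uv2 := revival_from_double uv tu b_neq0.
by rewrite !chi_half // (even_pairs_odd xy).
Qed.

Lemma revival_from_antipodal (t : R) u v :
  revival_from (cay S) t u v -> ~ periodic_at (cay S) t u ->
  ~~ odd n /\ antipodal u v.
Proof.
move=> [uv [a [b [ab1 tu]]]] nper.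
have uv_neq0 : u - v != 0 by rewrite subr_eq0; apply/eqP.
apply: double_eq0_half => //.
apply: (revival_from_double uv ((revival_from_propagator _ _ _ _ _).1 tu)).
apply/eqP => b0; apply: nper; exists a; split.
  apply/eqP; rewrite -sqrp_eq1 ?normr_ge0 // -ab1 b0 normr0 expr0n /=.
  by rewrite addr0.
by rewrite tu b0 scale0r addr0.
Qed.

Lemma antipodal_revival_from (t : R) u v :
  ~~ odd n -> antipodal u v -> integral_phases S t ->
  revival_from (cay S) t u v.
Proof.
move=> n_even uvE phases.
have uv_neq0 : u - v != 0 by rewrite uvE half_neq0.
have uv2 : (u - v) + (u - v) = 0 by rewrite uvE half_double_eq0.
split; first by apply/eqP; rewrite -subr_eq0.
(* The angles at the smallest representative of each parity; a and b are the half-sum and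
   half-difference of their phases. *)
pose P := t * eigval R S 0; pose Q := t * eigval R S 1.
pose a : R[i] := ((cos P + cos Q) / 2 +i* ((sin P + sin Q) / 2))%C.
pose b : R[i] := ((cos P - cos Q) / 2 +i* ((sin P - sin Q) / 2))%C.
have phaseE x : cis (t * eigval R S x) = a + b * chi R x (u - v).
  (* Pairs in [even_pairs] are strictly decreasing, which suffices for comparing x with 0 or 1. *)
  have cis_odd y : odd x = odd y -> (y <= x)%N ->
      cis (t * eigval R S x) = cis (t * eigval R S y).
    move=> xy; rewrite leq_eqVlt => /orP[/eqP/val_inj -> //|y_lt].
    apply/integral_phaseP/phases.
    by rewrite inE /= y_lt dvdn2 oddB ?(ltnW y_lt) // xy addbb.
  rewrite chi_half //; case: (boolP (odd x)) => ox.
    rewrite (cis_odd 1) ?ox //; last by rewrite odd_gt0.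
    by rewrite mulrN1 /a /b /cis -/Q; simpc; congr Complex; field.
  rewrite (cis_odd 0) ?(negPf ox) //.
  by rewrite mulr1 /a /b /cis -/P; simpc; congr Complex; field.
exists a, b; split.
  (* The parallelogram law for two unit complex numbers. *)
  rewrite -!add_Re2_Im2 -rmorphD /= -[RHS]/(1%:C)%C; congr (_%:C)%C.
  have := cos2Dsin2 P; have := cos2Dsin2 Q; lra.
have n_neq0 : n%:R != 0 :> R[i] by rewrite pnatr_eq0 -lt0n ltnW.
apply/revival_from_propagator => i; rewrite /propagator.
under eq_bigr do rewrite phaseE mulrDl -mulrA -chiD //.
rewrite big_split /= -!mulr_sumr.
under eq_bigr do rewrite chiC; under [X in b * X]eq_bigr do rewrite chiC.
rewrite !sum_chi // mulrDr (mulrCA _ a) (mulrCA _ b) !mulKf //.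
by rewrite (addrC (u - v)) addrA subrK !subr_eq0.
Qed.

End Revival.

(** * The gcd of the differences and the minimum time *)

Lemma intr_mul_gcd (R : realType) (r : R) (I : finType) (A : {set I})
    (D : I -> int) :
  (forall p, p \in A -> exists k : int, r * (D p)%:~R = k%:~R) ->
  exists k : int, r * (\big[gcdn/0]_(p in A) `|D p|)%N%:R = k%:~R.
Proof.
move=> rD; elim/big_ind: _ => [|p q|p pA].
- by exists 0; rewrite mulr0.
- move=> [k kE] [l lE]; have [x [y xy]] := Bezoutz p q.
  exists (x * k + y * l).
  rewrite -[(gcdn p q)%:R]/((gcdz p q)%:~R) -xy !intrD !intrM -kE -lE mulrDr.
  by rewrite !(mulrCA r).
(* The gcd runs over absolute values, so the sign of [D p] moves to the integer. *)
- have [k kE] := rD p pA; exists ((-1) ^+ (D p < 0)%R * k).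
  by rewrite -[_%:R]/(`|D p|%N%:Z%:~R) abszEsign !intrM mulrCA kE.
Qed.

Theorem corollary2p1 (R : realType) (n : nat) (hn : (2 <= n)%N)
    (S : {set 'Z_n}) (S0 : 0 \notin S) (SN : -%R @: S = S)
    (u v : 'Z_n) (t : R) :
  [/\ (* necessity: (c) always, (a) and (b) unless the revival is the
         degenerate one coming from periodicity *)
      revival (cay S) t u v ->
        (~ periodic_at (cay S) t u -> ~~ odd n /\ antipodal u v) /\
        integral_phases S t,
      (* sufficiency *)
      [/\ ~~ odd n, antipodal u v & integral_phases S t] ->
        revival (cay S) t u v
    & (* minimum time *)
      [/\ ~~ odd n, antipodal u v & integral_phases S t] ->
      forall D : 'Z_n -> 'Z_n -> int,
        (forall x y : 'Z_n, (x, y) \in even_pairs n ->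
           eig_diff R S x y = (D x y)%:~R) ->
        let M := (\big[gcdn/0]_(p in even_pairs n) `|D p.1 p.2|)%N in
        M <> 0%N ->
        let T : R := 2 * pi / M%:R in
        [/\ 0 < T, revival (cay S) T u v &
            forall t' : R, 0 < t' -> revival (cay S) t' u v -> T <= t']].
Proof.
(* Stated for any time, to serve at both t and T. *)
have suff_revival (s : R) :
    [/\ ~~ odd n, antipodal u v & integral_phases S s] -> revival (cay S) s u v.
  move=> [n_even uvE phases]; split; first exact: antipodal_revival_from.
  (* For the direction from v to u: n/2 is its own opposite in ['Z_n]. *)
  apply: antipodal_revival_from => //; rewrite /antipodal -opprB uvE.
  by apply/eqP; rewrite eq_sym -addr_eq0 half_double_eq0.
split=> [[uv vu]||[n_even uvE _] D DE M /eqP M_neq0 T].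
- split; last exact: (revival_from_integral hn SN uv).
  exact: (revival_from_antipodal hn SN uv).
- exact: suff_revival.
have M_gt0 : 0 < M%:R :> R by rewrite ltr0n lt0n.
have pi2_gt0 : 0 < 2 * pi :> R by rewrite mulr_gt0 ?pi_gt0.
have real_mul_int (s : R) (d : int) (k : R) : s * d%:~R = k ->
    s%:C%C * d%:~R = k%:C%C.
  by move=> <-; rewrite rmorphM /= rmorph_int.
split=> [||s s_gt0 [us _]].
- exact: divr_gt0.
- apply: suff_revival; split=> // x y xy.
  have /dvdnP[m mE] : (M %| `|D x y|)%N.
    exact: (biggcdn_inf (F := fun p => `|D p.1 p.2|%N) (x, y)).
  (* Since [T / (2 * pi)] is 1/M, the integer is the signed quotient of [D x y] by M. *)
  exists ((-1) ^+ (D x y < 0)%R * m%:Z); rewrite DE //.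
  rewrite -[RHS](rmorph_int (real_complex R)); apply: real_mul_int.
  rewrite {1}[D x y]intEsign !intrM mE PoszM intrM.
  have -> : T / (2 * pi) = M%:R^-1 by rewrite /T mulrAC divff ?gt_eqF // mul1r.
  rewrite mulrCA; congr (_ * _).
  by rewrite mulrC mulfK ?gt_eqF.
have phases := revival_from_integral hn SN us.
(* This integer is positive, hence at least 1, which rearranges to [T <= s]. *)
have [k kE] : exists k : int, s / (2 * pi) * M%:R = k%:~R.
  apply: (@intr_mul_gcd R _ _ _ (fun p => D p.1 p.2)) => -[x y] xy.
  have [k] := phases x y xy; rewrite DE // => kE; exists k.
  by apply: (@complexI R); rewrite rmorphM /= !rmorph_int.
have k_gt0 : 0 < k%:~R :> R by rewrite -kE mulr_gt0 ?divr_gt0.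
rewrite /T ler_pdivrMr // -[leLHS]mul1r -ler_pdivlMr // mulrAC kE.
by rewrite -[1]/(1%:~R) ler_int -gtz0_ge1 -(ltr0z R).
Qed.
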